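(* Let $A,B,C$ be pairwise disjoint finite sets, let $\mathcal{A}_{AB},\mathcal{A}_{BC}$ be affine spaces over a field $\mathbb{F}$ on $A\uplus B$ and $B\uplus C$ respectively, let $\{\mathcal{A}_{AB},\mathcal{A}_{BC}\}$ be a rigid pair, and let $\mathcal{V}_{AB},\mathcal{V}_{BC}$ be the vector space translates of $\mathcal{A}_{AB},\mathcal{A}_{BC}$ respectively. Then: 1. The full sum property of $\{\mathcal{A}_{AB},\mathcal{A}_{BC}\}$ is equivalent to $\hat{\mathcal{A}}_{AB}\leftrightarrow\hat{\mathcal{A}}_{BC}$ being nonvoid whenever $\mathcal{V}_{AB},\mathcal{V}_{BC}$ are the vector space translates of the affine spaces $\hat{\mathcal{A}}_{AB},\hat{\mathcal{A}}_{BC}$ respectively. Further, when the full sum property holds for $\{\mathcal{A}_{AB},\mathcal{A}_{BC}\}$, $\hat{\mathcal{A}}_{AB}\leftrightarrow\hat{\mathcal{A}}_{BC}$ has vector space translate $\mathcal{V}_{AB}\leftrightarrow\mathcal{V}_{BC}$. 2. The zero intersection property of $\{\mathcal{A}_{AB},\mathcal{A}_{BC}\}$ is equivalent to the statement that, if $(f_A,f_C)\in\mathcal{A}_{AB}\leftrightarrow\mathcal{A}_{BC}$ and $(f_A,f_B,f_C),(f_A,f'_B,f_C)\in\mathcal{A}_{AB}\cap\mathcal{A}_{BC}$, then $f_B=f'_B$. 3. The pair $\{\mathcal{A}_{AB},\mathcal{A}_{BC}\}$ is rigid iff $r(\mathcal{V}_{AB}+\mathcal{V}_{BC})=r(\mathcal{V}_{AB})+r(\mathcal{V}_{BC})$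 and $r(\mathcal{V}_{AB}^{\perp}+\mathcal{V}_{BC}^{\perp})=r(\mathcal{V}_{AB}^{\perp})+r(\mathcal{V}_{BC}^{\perp})$. 4. The pair $\{\mathcal{A}_{AB},\mathcal{A}_{BC}\}$ has the zero intersection (respectively full sum) property iff $\{\mathcal{V}_{AB}^{\perp},\mathcal{V}_{BC}^{\perp}\}$ has the full sum (respectively zero intersection) property. Therefore $\{\mathcal{A}_{AB},\mathcal{A}_{BC}\}$ is rigid iff $\{\mathcal{V}_{AB}^{\perp},\mathcal{V}_{BC}^{\perp}\}$ is rigid.
   Context: A vector on a finite set $X$ over $\mathbb{F}$ is a function $X\to\mathbb{F}$. For disjoint $X,Y$, a vector on $X\uplus Y$ is written $(f_X,f_Y)$ and a space on $X\uplus Y$ carries the subscript $XY$. $\mathcal{F}_X$ is the space of all vectors on $X$, $\mathbf{0}_X$ the zero space. $r$ is dimension. An affine space on $X$ is a set $x_X+\mathcal{V}_X$ with $x_X$ a vector and $\mathcal{V}_X$ a vector space on $X$, called its vector space translate. $\mathcal{V}_X^{\perp}$ is the set of all $g_X$ with $\sum_{e\in X}f(e)g(e)=0$ for all $f_X\in\mathcal{V}_X$. For pairwise disjoint $S,P,Q$ and collections of vectors $\mathcal{K}_{SP},\mathcal{K}_{PQ}$: restriction $\mathcal{K}_{SP}\circ S=\{f_S:(f_S,f_P)\in\mathcal{K}_{SP}\text{ for some }f_P\}$; contraction $\mathcal{K}_{SP}\times S=\{f_S:(f_S,0_P)\in\mathcal{K}_{SP}\}$; sum $\mathcal{K}_{SP}+\mathcal{K}_{PQ}=\{(f_S,f_P+g_P,g_Q):(f_S,f_P)\in\mathcal{K}_{SP},(g_P,g_Q)\in\mathcal{K}_{PQ}\}$;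 intersection $\mathcal{K}_{SP}\cap\mathcal{K}_{PQ}=\{(f_S,h_P,g_Q):(f_S,h_P)\in\mathcal{K}_{SP},(h_P,g_Q)\in\mathcal{K}_{PQ}\}$; matched composition $\mathcal{K}_{SP}\leftrightarrow\mathcal{K}_{PQ}=\{(f_S,g_Q):(f_S,h_P)\in\mathcal{K}_{SP},(h_P,g_Q)\in\mathcal{K}_{PQ}\text{ for some }h_P\}$. A pair $\{\mathcal{A}_{AB},\mathcal{A}_{BC}\}$ of affine spaces with vector space translates $\mathcal{V}_{AB},\mathcal{V}_{BC}$ has the full sum property iff $\mathcal{V}_{AB}\circ B+\mathcal{V}_{BC}\circ B=\mathcal{F}_B$, and the zero intersection property iff $(\mathcal{V}_{AB}\times B)\cap(\mathcal{V}_{BC}\times B)=\mathbf{0}_B$. It is rigid iff it has both properties (when $B=\emptyset$ it is taken to be rigid). *)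

(* Defs.v *)
From mathcomp Require Import all_boot all_order all_algebra.
From mathcomp Require Import boolp classical_sets.

Set Implicit Arguments.
Unset Strict Implicit.
Unset Printing Implicit Defensive.

Import GRing.Theory.
Local Open Scope ring_scope.
Local Open Scope classical_set_scope.

(* Vectors on X over F. The disjoint union of X and Y is the sum type X + Y.
   F^o is F seen as a one-dimensional space over itself, so that vec F X is a
   vectType over F. *)
Definition vec (F : fieldType) (X : finType) : vectType F := {ffun X -> F^o}.
Arguments vec F X%_type.

Section Collections.
Context {F : fieldType}.
Implicit Types S P Q X : finType.

(* the vector (f_S, f_P) *)
Definition vpair {S P} (f : vec F S) (g : vec F P) : vec F (S + P) :=
  [ffun x : S + P => match x with inl s => f s | inr p => g p end].

(* The index set of a collection on a disjoint union is ordered here, whence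
   two restrictions and two contractions: to the left and to the right part. *)
Definition restrictl {S P} (K : set (vec F (S + P))) : set (vec F S) :=
  [set f | exists g : vec F P, K (vpair f g)].

Definition restrictr {S P} (K : set (vec F (S + P))) : set (vec F P) :=
  [set g | exists f : vec F S, K (vpair f g)].

Definition contractl {S P} (K : set (vec F (S + P))) : set (vec F S) :=
  [set f | K (vpair f 0)].

Definition contractr {S P} (K : set (vec F (S + P))) : set (vec F P) :=
  [set g | K (vpair 0 g)].

Definition csum {S P Q} (K : set (vec F (S + P))) (L : set (vec F (P + Q))) :
    set (vec F (S + P + Q)) :=
  [set h | exists fS fP gP gQ, [/\ K (vpair fS fP), L (vpair gP gQ) &
     h = vpair (vpair fS (fP + gP)) gQ]].

Definition cinter {S P Q} (K : set (vec F (S + P))) (L : set (vec F (P + Q))) :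
    set (vec F (S + P + Q)) :=
  [set h | exists fS hP gQ, [/\ K (vpair fS hP), L (vpair hP gQ) &
     h = vpair (vpair fS hP) gQ]].

Definition mcomp {S P Q} (K : set (vec F (S + P))) (L : set (vec F (P + Q))) :
    set (vec F (S + Q)) :=
  [set h | exists fS hP gQ, [/\ K (vpair fS hP), L (vpair hP gQ) &
     h = vpair fS gQ]].

Definition is_vspace {X} (V : set (vec F X)) : Prop :=
  exists U : {vspace vec F X}, V = [set` U].

(* Dimension of a vector space given as a set; 0 if V is not a vector space. *)
Definition r {X} (V : set (vec F X)) : nat :=
  \dim (xget 0%VS [set U : {vspace vec F X} | V = [set` U]]).

Lemma rE {X} (U : {vspace vec F X}) : r [set` U] = \dim U.
Proof.
rewrite /r; case: xgetP => [W _ /= UW|/(_ U)]; last by case.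
congr (\dim _); apply/vspaceP => x.
by have /= := congr1 (fun A : set _ => A x) UW => xUW; apply/idP/idP; rewrite xUW.
Qed.

Definition perp {X} (V : set (vec F X)) : set (vec F X) :=
  [set g : vec F X | forall f : vec F X, V f -> \sum_(e : X) f e * g e = 0].

(* K is an affine space with vector space translate V *)
Definition affine_translate {X} (K V : set (vec F X)) : Prop :=
  is_vspace V /\ exists x : vec F X, K = [set x + v | v in V].

(* The translate of an affine space is unique, so the existential quantifiers
   below only name the translates of K and L. *)
Definition full_sum {S P Q}
    (K : set (vec F (S + P))) (L : set (vec F (P + Q))) : Prop :=
  exists V W, [/\ affine_translate K V, affine_translate L W &
    [set f + g | f in restrictr V & g in restrictl W] = [set: vec F P]].

Definition zero_intersection {S P Q}
    (K : set (vec F (S + P))) (L : set (vec F (P + Q))) : Prop :=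
  exists V W, [/\ affine_translate K V, affine_translate L W &
    contractr V `&` contractl W = [set (0 : vec F P)]].

(* For empty P both properties hold for every pair of affine spaces. *)
Definition rigid {S P Q}
    (K : set (vec F (S + P))) (L : set (vec F (P + Q))) : Prop :=
  full_sum K L /\ zero_intersection K L.

End Collections.

(* Main.v *)
Require Import Defs.
From HB Require Import structures.
From mathcomp Require Import all_boot all_order all_algebra.
From mathcomp Require Import boolp classical_sets.

Local Open Scope ring_scope.
Local Open Scope classical_set_scope.

Import GRing.Theory.
Set Implicit Arguments.
Unset Strict Implicit.
Unset Printing Implicit Defensive.

(** For spaces V on A + B and W on B + C, everything is governed by two
    spaces on the common part B: the sum V∘B + W∘B of the restrictions and the
    intersection (V×B) ∩ (W×B) of the contractions.

    - Matching an element of x + V with one of y + W amounts to solving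
      x_B + v_B = y_B + w_B, that is, to writing y_B - x_B as a sum of an
      element of V∘B and one of W∘B.  Hence all translates can be matched iff
      V∘B + W∘B is everything ([full_sum_mcomp]).  Differences of
      matches of two affine spaces are matches of their translates, which gives
      the translate of the composition ([affine_mcomp]).
    - Two values h, h' on B that match the same (f_A, f_C) differ by an element
      of (V×B) ∩ (W×B), and conversely any element of it can be added to
      a matching value.  So uniqueness is the zero intersection property as
      soon as some match exists, which the full sum property provides
      ([unique_match_zero_intersection]).
    - V + W is the sum of the two copies of V and W inside the vectors on
      A + B + C; these copies meet exactly in the extensions by zero
      of (V×B) ∩ (W×B), so the dimensions add up iff the latter vanishes
      ([r_csum]).
    - Orthogonality exchanges restriction with contraction and sum with
      intersection, so (V∘B + W∘B)^⊥ = (V^⊥×B) ∩ (W^⊥×B) ([perp_sum_restrict]);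
      a space is everything iff its orthogonal is zero, whence
      [full_sum_perp].  The dual equivalence follows from V^⊥⊥ = V
      ([perpK]), and both rank equalities follow from [r_csum] applied to
      (V, W) and to (V^⊥, W^⊥). *)

Section Vectors.
Context {F : fieldType}.
Implicit Types S P Q X : finType.

(** * Vectors on a disjoint union *)

Lemma vpairD S P (f f' : vec F S) (g g' : vec F P) :
  vpair (f + f') (g + g') = vpair f g + vpair f' g'.
Proof. by apply/ffunP => -[s|p]; rewrite !ffunE. Qed.

Lemma vpairB S P (f f' : vec F S) (g g' : vec F P) :
  vpair (f - f') (g - g') = vpair f g - vpair f' g'.
Proof. by apply/ffunP => -[s|p]; rewrite !ffunE. Qed.

Lemma vpairZ S P (a : F) (f : vec F S) (g : vec F P) :
  vpair (a *: f) (a *: g) = a *: vpair f g.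
Proof. by apply/ffunP => -[s|p]; rewrite !ffunE. Qed.

Lemma vpair0 S P : vpair (0 : vec F S) (0 : vec F P) = 0.
Proof. by apply/ffunP => -[s|p]; rewrite !ffunE. Qed.

Lemma vpair_inj S P (f f' : vec F S) (g g' : vec F P) :
  vpair f g = vpair f' g' -> f = f' /\ g = g'.
Proof.
move=> /ffunP e; split; apply/ffunP => x.
  by have := e (inl x); rewrite !ffunE.
by have := e (inr x); rewrite !ffunE.
Qed.

Lemma vpair_surj S P (h : vec F (S + P)) : exists f g, h = vpair f g.
Proof.
exists [ffun s => h (inl s)], [ffun p => h (inr p)].
by apply/ffunP => -[s|p]; rewrite !ffunE.
Qed.

(** * Vector spaces and affine spaces as sets of vectors *)

Section VectorSpace.
Context {X : finType} {V : set (vec F X)} (V_vs : is_vspace V).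

Lemma is_vspace0 : V 0.
Proof. by have [U ->] := V_vs; rewrite /= mem0v. Qed.

Lemma is_vspaceD u v : V u -> V v -> V (u + v).
Proof. by have [U ->] := V_vs; apply: memvD. Qed.

Lemma is_vspaceB u v : V u -> V v -> V (u - v).
Proof. by have [U ->] := V_vs; apply: memvB. Qed.

Lemma is_vspaceZ (a : F) u : V u -> V (a *: u).
Proof. by have [U ->] := V_vs; apply: memvZ. Qed.

End VectorSpace.

(** A linearly closed set contains a subspace of maximal dimension, which must
    exhaust it: adding to it a further vector of the set would enlarge it. *)
Lemma is_vspace_lin X (K : set (vec F X)) :
  K 0 -> (forall (a : F) u v, K u -> K v -> K (a *: u + v)) -> is_vspace K.
Proof.
move=> K0 Klin.
pose inK n := `[< exists2 U : {vspace vec F X}, [set` U] `<=` K & \dim U = n >].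
have inK0 : exists n, inK n.
  exists 0%N; apply/asboolP; exists 0%VS; last exact: dimv0.
  by move=> u /=; rewrite memv0 => /eqP ->.
have inK_le n : inK n -> (n <= \dim {:vec F X})%N.
  by move=> /asboolP[U _ <-]; apply/dimvS/subvf.
case: (ex_maxnP inK0 inK_le) => n /asboolP[U UK dimU] maxn.
exists U; apply/seteqP; split => [x Kx /=|x /UK //].
have /maxn : inK (\dim (U + <[x]>)%VS).
  apply/asboolP; exists (U + <[x]>)%VS => // y.
  move=> /= /memv_addP[u uU [_ /vlineP[a ->] ->]].
  by rewrite addrC; apply: Klin => //; apply: UK.
rewrite -dimU => le_dim.
suff /eqP -> : U == (U + <[x]>)%VS by apply: (subvP (addvSr _ _)); apply: memv_line.
by rewrite eqEdim addvSl.
Qed.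

Lemma affine_nonempty X (K V : set (vec F X)) :
  affine_translate K V -> K !=set0.
Proof. by move=> [V_vs [x ->]]; exists (x + 0), 0 => //; apply: is_vspace0. Qed.

Lemma affine_mem X (K V : set (vec F X)) x y :
  affine_translate K V -> K x -> K y <-> V (y - x).
Proof.
move=> [V_vs [z ->]] [v Vv <-]; split => [[w Vw <-]|Vyx].
  by rewrite opprD addrACA subrr add0r; apply: is_vspaceB.
exists (v + (y - (z + v))); first exact: is_vspaceD.
by rewrite addrA subrKC.
Qed.

Lemma affine_of_mem X (K V : set (vec F X)) x :
  is_vspace V -> (forall y, K y <-> V (y - x)) -> affine_translate K V.
Proof.
move=> V_vs KV; split=> //; exists x; apply/seteqP; split => [y /KV Vyx|y [v Vv <-]].
  by exists (y - x) => //; rewrite subrKC.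
by apply/KV; rewrite addrAC subrr add0r.
Qed.

Lemma affine_self X (V : set (vec F X)) : is_vspace V -> affine_translate V V.
Proof. by move=> V_vs; apply: (@affine_of_mem _ _ _ 0) => // y; rewrite subr0. Qed.

Lemma affine_translate_unique X (K V V' : set (vec F X)) :
  affine_translate K V -> affine_translate K V' -> V = V'.
Proof.
move=> KV KV'; have [x Kx] := affine_nonempty KV.
have mem y : V y <-> V' y.
  have := affine_mem (x + y) KV' Kx; have := affine_mem (x + y) KV Kx.
  by rewrite addrAC subrr add0r => <- <-.
by apply/seteqP; split => y /mem.
Qed.

Section Pair.
Context {S P Q : finType}.
Implicit Types (V K : set (vec F (S + P))) (W L : set (vec F (P + Q))).

(** The translate of an affine space is determined by it, so both properties
    may be tested on any known pair of translates. *)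
Lemma full_sumE K L V W : affine_translate K V -> affine_translate L W ->
  full_sum K L <->
  forall h, exists f g g' l, [/\ V (vpair f g), W (vpair g' l) & h = g + g'].
Proof.
move=> KV LW; split => [[V' [W' [KV' LW' full]]] h|full].
  rewrite (affine_translate_unique KV KV') (affine_translate_unique LW LW').
  have : [set: vec F P] h by [].
  by rewrite -full => -[g [f Vfg] [g' [l Wgl] <-]]; exists f, g, g', l.
exists V, W; split=> //; apply/seteqP; split=> // h _.
by have [f [g [g' [l [Vfg Wgl ->]]]]] := full h; exists g; [exists f|exists g'; [exists l|]].
Qed.

Lemma zero_intersectionE K L V W :
  affine_translate K V -> affine_translate L W ->
  zero_intersection K L <->
  forall h : vec F P, V (vpair 0 h) -> W (vpair h 0) -> h = 0.
Proof.
move=> KV LW; split => [[V' [W' [KV' LW' zero]]] h|zero].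
  rewrite (affine_translate_unique KV KV') (affine_translate_unique LW LW').
  move=> Vh Wh; have : (contractr V' `&` contractl W') h by [].
  by rewrite zero.
exists V, W; split=> //; apply/seteqP; split => [h [Vh Wh]|h -> /=].
  exact: zero.
by split; rewrite /contractr /contractl /= vpair0;
  [case: KV => V_vs _|case: LW => V_vs _]; apply: is_vspace0.
Qed.

Lemma full_sum_translate K L V W :
  affine_translate K V -> affine_translate L W ->
  full_sum K L <-> full_sum V W.
Proof.
move=> KV LW; have [[V_vs _] [W_vs _]] := (KV, LW).
by rewrite (full_sumE KV LW) (full_sumE (affine_self V_vs) (affine_self W_vs)).
Qed.

Lemma zero_intersection_translate K L V W :
  affine_translate K V -> affine_translate L W ->
  zero_intersection K L <-> zero_intersection V W.
Proof.
move=> KV LW; have [[V_vs _] [W_vs _]] := (KV, LW).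
by rewrite (zero_intersectionE KV LW)
  (zero_intersectionE (affine_self V_vs) (affine_self W_vs)).
Qed.

(** * Matched composition *)

(** To reach an arbitrary h from nonvoidness, shift one of the two spaces
    by h on the common part and keep the other one linear: a match then splits
    h. *)
Lemma full_sum_mcomp K L V W :
  affine_translate K V -> affine_translate L W ->
  full_sum K L <->
  forall K' L', affine_translate K' V -> affine_translate L' W ->
    mcomp K' L' !=set0.
Proof.
move=> KV LW; rewrite (full_sumE KV LW).
have [V_vs _] := KV; have [W_vs _] := LW.
split => [full K' L' KV' LW'|nonvoid h].
  have [x Kx] := affine_nonempty KV'; have [y Ly] := affine_nonempty LW'.
  have [xS [xP ex]] := vpair_surj x; have [yP [yQ ey]] := vpair_surj y.
  have [f [g [g' [l [Vfg Wgl e]]]]] := full (yP - xP).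
  (* g + g' = yP - xP, so x + (f, g) and y - (g', l) agree on P *)
  exists (vpair (xS + f) (yQ - l)), (xS + f), (xP + g), (yQ - l).
  split=> //; first by apply/(affine_mem _ KV' Kx); rewrite ex vpairD addrAC subrr add0r.
  have -> : xP + g = yP - g'.
    by apply/eqP; rewrite eq_sym subr_eq -addrA -e subrKC.
  apply/(affine_mem _ LW' Ly); rewrite ey vpairB addrAC subrr sub0r.
  by rewrite -scaleN1r; apply: is_vspaceZ.
pose K' := [set vpair 0 h + v | v in V].
have KV' : affine_translate K' V by split=> //; exists (vpair 0 h).
have [_ [f [k [l [[v Vv e] Wkl _]]]]] := nonvoid K' W KV' (affine_self W_vs).
have [vS [vP ev]] := vpair_surj v; move: e Vv; rewrite ev -vpairD => e Vv.
have [_ ek] := vpair_inj e.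
exists (- vS), (- vP), k, l; split=> //; last by rewrite -ek addrCA addNr addr0.
by rewrite -(scaleN1r vS) -(scaleN1r vP) vpairZ; apply: is_vspaceZ.
Qed.

Lemma mcomp_vspace V W : is_vspace V -> is_vspace W -> is_vspace (mcomp V W).
Proof.
move=> V_vs W_vs; apply: is_vspace_lin.
  by exists 0, 0, 0; rewrite !vpair0; split=> //; apply: is_vspace0.
move=> a _ _ [f [h [l [Vfh Whl ->]]]] [f' [h' [l' [Vfh' Whl' ->]]]].
exists (a *: f + f'), (a *: h + h'), (a *: l + l').
by rewrite !vpairD !vpairZ; split=> //; apply: is_vspaceD => //; apply: is_vspaceZ.
Qed.

(** Once a match (f0, h0, l0) is fixed, subtracting it turns the matches of the
    affine spaces into those of their translates, and adding it turns them
    back. *)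
Lemma affine_mcomp K L V W :
  affine_translate K V -> affine_translate L W -> mcomp K L !=set0 ->
  affine_translate (mcomp K L) (mcomp V W).
Proof.
move=> KV LW [_ [f0 [h0 [l0 [Kfh Lhl _]]]]].
have [V_vs _] := KV; have [W_vs _] := LW.
apply: (@affine_of_mem _ _ _ (vpair f0 l0)); first exact: mcomp_vspace.
move=> y; split => [[f [h [l [Kfh' Lhl' ->]]]]|[f [h [l [Vfh Whl e]]]]].
  exists (f - f0), (h - h0), (l - l0); rewrite !vpairB; split=> //.
    exact/(affine_mem _ KV Kfh).
  exact/(affine_mem _ LW Lhl).
exists (f0 + f), (h0 + h), (l0 + l); rewrite !vpairD -e subrKC; split=> //.
  by apply/(affine_mem _ KV Kfh); rewrite addrAC subrr add0r.
by apply/(affine_mem _ LW Lhl); rewrite addrAC subrr add0r.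
Qed.

Lemma cinter_vpair K L f h l :
  cinter K L (vpair (vpair f h) l) <-> K (vpair f h) /\ L (vpair h l).
Proof.
split => [[f' [h' [l' [Kfh Lhl e]]]]|[Kfh Lhl]]; last by exists f, h, l.
by have [/vpair_inj[-> ->] ->] := vpair_inj e.
Qed.

(** Nonvoidness is essential: for a void composition the uniqueness of
    the matched value is vacuous and says nothing about V and W. *)
Lemma unique_match_zero_intersection K L V W :
  affine_translate K V -> affine_translate L W -> mcomp K L !=set0 ->
  zero_intersection K L <->
  forall f h h' l, mcomp K L (vpair f l) ->
    cinter K L (vpair (vpair f h) l) -> cinter K L (vpair (vpair f h') l) ->
    h = h'.
Proof.
move=> KV LW [_ [f0 [h0 [l0 [Kfh Lhl _]]]]]; rewrite (zero_intersectionE KV LW).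
split => [zero f h h' l _ /cinter_vpair[Kh Lh] /cinter_vpair[Kh' Lh']|uniq h Vh Wh].
  apply/eqP; rewrite -subr_eq0; apply/eqP; apply: zero.
    by rewrite -(subrr f) vpairB; apply/(affine_mem _ KV Kh').
  by rewrite -(subrr l) vpairB; apply/(affine_mem _ LW Lh').
apply: (addrI h0); rewrite addr0.
apply: (uniq f0 _ _ l0); first by exists f0, h0, l0.
  apply/cinter_vpair; split.
    by apply/(affine_mem _ KV Kfh); rewrite -vpairB subrr addrAC subrr add0r.
  by apply/(affine_mem _ LW Lhl); rewrite -vpairB subrr addrAC subrr add0r.
exact/cinter_vpair.
Qed.

(** * Dimension of the sum *)

(** The extensions by zero through which both spaces become subspaces of the
    vectors on S + P + Q, where [csum] is an ordinary sum. *)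
Definition extendr (v : vec F (S + P)) : vec F (S + P + Q) := vpair v 0.

Definition extendl (w : vec F (P + Q)) : vec F (S + P + Q) :=
  [ffun x => match x with
             | inl (inl _) => 0
             | inl (inr p) => w (inl p)
             | inr q => w (inr q)
             end].

Lemma extendl_vpair (g : vec F P) (l : vec F Q) :
  extendl (vpair g l) = vpair (vpair 0 g) l.
Proof. by apply/ffunP => -[[s|p]|q]; rewrite !ffunE. Qed.

Lemma extendr_linear : linear extendr.
Proof. by move=> a u v; rewrite /extendr -vpairZ -vpairD scaler0 addr0. Qed.

Lemma extendl_linear : linear extendl.
Proof.
by move=> a u v; apply/ffunP => -[[s|p]|q]; rewrite !ffunE // scaler0 addr0.
Qed.

HB.instance Definition _ :=
  GRing.isLinear.Build F (vec F (S + P)) (vec F (S + P + Q)) _ extendr extendr_linear.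
HB.instance Definition _ :=
  GRing.isLinear.Build F (vec F (P + Q)) (vec F (S + P + Q)) _ extendl extendl_linear.

Lemma lker_extendr : lker (linfun extendr) == 0%VS.
Proof.
apply/lker0P => u v; rewrite !lfunE /= => e.
by have [] := vpair_inj e.
Qed.

Lemma lker_extendl : lker (linfun extendl) == 0%VS.
Proof.
apply/lker0P => u v; rewrite !lfunE /=.
have [g [l ->]] := vpair_surj u; have [g' [l' ->]] := vpair_surj v.
by rewrite !extendl_vpair => /vpair_inj[/vpair_inj[_ ->] ->].
Qed.

Lemma csum_vspace (U : {vspace vec F (S + P)}) (U' : {vspace vec F (P + Q)}) :
  csum [set` U] [set` U'] =
  [set` (linfun extendr @: U + linfun extendl @: U')%VS].
Proof.
apply/seteqP; split => [_ [f [g [g' [l [Ufg Ugl ->]]]]]|h] /=.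
  apply/memv_addP; exists (extendr (vpair f g)).
    by rewrite -[extendr _]lfunE memv_img.
  exists (extendl (vpair g' l)); first by rewrite -[extendl _]lfunE memv_img.
  by rewrite extendl_vpair -!vpairD addr0 add0r.
move=> /memv_addP[_ /memv_imgP[u Uu ->] [_ /memv_imgP[u' Uu' ->] ->]].
move: Uu Uu'; rewrite !lfunE /=.
have [f [g ->]] := vpair_surj u; have [g' [l ->]] := vpair_surj u'.
move=> Uu Uu'; exists f, g, g', l; split=> //.
by rewrite extendl_vpair -!vpairD addr0 add0r.
Qed.

(** A vector common to the two copies is zero on S (seen from W) and on Q (seen
    from V), and its part on P is in both contractions. *)
Lemma r_csum V W : is_vspace V -> is_vspace W ->
  zero_intersection V W <-> (r (csum V W) = r V + r W)%N.
Proof.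
move=> V_vs W_vs; rewrite (zero_intersectionE (affine_self V_vs) (affine_self W_vs)).
case: V_vs W_vs => U -> [U' ->]; rewrite csum_vspace !rE.
rewrite -(@limg_dim_eq _ _ _ (linfun extendr) U); last first.
  by rewrite (eqP lker_extendr) capv0.
rewrite -(@limg_dim_eq _ _ _ (linfun extendl) U'); last first.
  by rewrite (eqP lker_extendl) capv0.
set X := (_ @: U)%VS; set Y := (_ @: U')%VS.
have dimXY : (\dim (X + Y) == \dim X + \dim Y)%N = (X :&: Y <= 0)%VS.
  by rewrite (dimv_add_leqif X Y).
split => [zero|/eqP].
  apply/eqP; rewrite dimXY; apply/subvP => y.
  rewrite memv_cap => /andP[/memv_imgP[u Uu ->] /memv_imgP[u' Uu']].
  move: Uu Uu'; rewrite !lfunE /=.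
  have [f [g ->]] := vpair_surj u; have [g' [l ->]] := vpair_surj u'.
  rewrite extendl_vpair => Uu Uu' /vpair_inj[/vpair_inj[ef eg] el].
  move: Uu Uu'; rewrite ef -eg -el => Uu Uu'.
  by rewrite (zero g Uu Uu') /extendr !vpair0 mem0v.
rewrite dimXY => /subvP XY0 h Uh U'h.
have /XY0 : extendr (vpair 0 h) \in (X :&: Y)%VS.
  rewrite memv_cap -{1}[extendr _]lfunE memv_img //=.
  by rewrite /extendr -extendl_vpair -[extendl _]lfunE memv_img.
rewrite memv0 => /eqP; rewrite /extendr -!vpair0.
by move=> /vpair_inj[/vpair_inj[_ ->]].
Qed.

End Pair.

(** * Orthogonality *)

Definition dot X (f g : vec F X) : F := \sum_e f e * g e.

Lemma dotC X (f g : vec F X) : dot f g = dot g f.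
Proof. by apply: eq_bigr => e _; rewrite mulrC. Qed.

Lemma dotDl X (f f' g : vec F X) : dot (f + f') g = dot f g + dot f' g.
Proof. by rewrite -big_split; apply: eq_bigr => e _; rewrite ffunE mulrDl. Qed.

Lemma dotZl X a (f g : vec F X) : dot (a *: f) g = a * dot f g.
Proof. by rewrite mulr_sumr; apply: eq_bigr => e _; rewrite ffunE mulrA. Qed.

Lemma dot0l X (g : vec F X) : dot 0 g = 0.
Proof. by apply: big1 => e _; rewrite ffunE mul0r. Qed.

Lemma dot_vpair S P (f f' : vec F S) (g g' : vec F P) :
  dot (vpair f g) (vpair f' g') = dot f f' + dot g g'.
Proof.
by rewrite /dot big_sumType; congr (_ + _); apply: eq_bigr => e _; rewrite !ffunE.
Qed.

Lemma perp_vspace X (V : set (vec F X)) : is_vspace (perp V).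
Proof.
apply: is_vspace_lin => [f _|a u v perpu perpv f Vf].
  by rewrite -/(dot f 0) dotC dot0l.
rewrite -/(dot f (a *: u + v)) dotC dotDl dotZl -2!(dotC f).
by rewrite [dot f u]perpu // [dot f v]perpv // mulr0 addr0.
Qed.

Definition unitv X (e : X) : vec F X := [ffun e' => (e' == e)%:R].

Lemma linear_dot X (phi : {linear vec F X -> F^o}) (f : vec F X) :
  phi f = dot f ([ffun e => phi (unitv e)] : vec F X).
Proof.
have {1}-> : f = \sum_e f e *: unitv e.
  apply/ffunP => e; rewrite sum_ffunE (bigD1 e) //= big1 => [|e' e'e].
    by rewrite !ffunE eqxx addr0 [_ *: _]mulr1.
  by rewrite !ffunE eq_sym (negbTE e'e) scaler0.
by rewrite linear_sum; apply: eq_bigr => e _; rewrite linearZ !ffunE.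
Qed.

(** If x is outside V, then x minus its projection on V has a nonzero
    coordinate e.  The functional that sends f to coordinate e of f minus its
    projection vanishes on V but not at x; it is represented by a vector, which
    is orthogonal to V but not to x. *)
Lemma perpK X (V : set (vec F X)) : is_vspace V -> perp (perp V) = V.
Proof.
move=> [U ->]; apply/seteqP; split => [x perpx|x Ux g perpg]; last first.
  by have := perpg x Ux; rewrite -/(dot x g) dotC.
rewrite /=; apply: contraT => xU.
have : x - projv U x != 0.
  by apply: contraNneq xU => /eqP; rewrite subr_eq0 => /eqP ->; apply: memv_proj.
case/eqP; apply/ffunP => e; rewrite [RHS]ffunE.
pose phi (f : vec F X) : F^o := (f - projv U f) e.
have phi_lin : linear phi.
  move=> a u v; rewrite /phi linearP opprD addrACA -scalerBr.
  by rewrite !ffunE.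
pose phiL := GRing.isLinear.Build F (vec F X) F^o _ phi phi_lin.
pose Phi : {linear vec F X -> F^o} := HB.pack phi phiL.
have phi_dot := linear_dot Phi.
rewrite -[LHS]/(Phi x) phi_dot dotC; apply: perpx => f Uf.
by rewrite -[LHS]phi_dot /= /phi projv_id // subrr ffunE.
Qed.

Lemma perpT X : perp [set: vec F X] = [set 0].
Proof.
apply/seteqP; split => [g perpg|_ -> f _]; last by rewrite -/(dot f 0) dotC dot0l.
apply/ffunP => e; have := perpg (unitv e) I.
rewrite (bigD1 e) //= big1 => [|e' e'e].
  by rewrite !ffunE eqxx mul1r addr0.
by rewrite !ffunE (negbTE e'e) mul0r.
Qed.

Lemma perp0 X : perp [set 0] = [set: vec F X].
Proof.
apply/seteqP; split=> // g _ _ ->; exact: dot0l.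
Qed.

Section PerpPair.
Context {S P Q : finType}.
Context (V : set (vec F (S + P))) (W : set (vec F (P + Q))).
Context (V_vs : is_vspace V) (W_vs : is_vspace W).

Let sum_restrict : set (vec F P) :=
  [set f + g | f in restrictr V & g in restrictl W].

(** Against a vector that vanishes on S, an element of V is only seen through
    its restriction to P; likewise for W and Q.  The sum of the restrictions
    contains each of them, so being orthogonal to it is the conjunction of the
    two conditions. *)
Lemma perp_sum_restrict :
  perp sum_restrict = contractr (perp V) `&` contractl (perp W).
Proof.
apply/seteqP; split => [h perph|h [Vh Wh] _ [g [f Vfg] [g' [l Wgl] <-]]].
  split => v.
    have [f [g ->]] := vpair_surj v => Vfg.
    rewrite -/(dot (vpair f g) (vpair 0 h)) dot_vpair dotC dot0l add0r.
    apply: perph; exists g; first by exists f.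
    by exists 0; rewrite ?addr0 //; exists 0; rewrite vpair0; apply: is_vspace0.
  have [g [l ->]] := vpair_surj v => Wgl.
  rewrite -/(dot (vpair g l) (vpair h 0)) dot_vpair [dot l _]dotC dot0l addr0.
  apply: perph; exists 0; first by exists 0; rewrite vpair0; apply: is_vspace0.
  by exists g; rewrite ?add0r //; exists l.
rewrite -/(dot (g + g') h) dotDl.
have : dot (vpair f g) (vpair 0 h) = 0 by apply: Vh.
have : dot (vpair g' l) (vpair h 0) = 0 by apply: Wh.
rewrite !dot_vpair (dotC f) (dotC l) !dot0l add0r addr0 => -> ->.
by rewrite addr0.
Qed.

Lemma sum_restrict_vspace : is_vspace sum_restrict.
Proof.
apply: is_vspace_lin.
  exists 0; first by exists 0; rewrite vpair0; apply: is_vspace0.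
  by exists 0; rewrite ?addr0 //; exists 0; rewrite vpair0; apply: is_vspace0.
move=> a _ _ [g [f Vfg] [k [l Wkl] <-]] [g' [f' Vfg'] [k' [l' Wkl'] <-]].
exists (a *: g + g').
  by exists (a *: f + f'); rewrite vpairD vpairZ; apply: is_vspaceD => //; apply: is_vspaceZ.
exists (a *: k + k'); last by rewrite scalerDr addrACA.
by exists (a *: l + l'); rewrite vpairD vpairZ; apply: is_vspaceD => //; apply: is_vspaceZ.
Qed.

(** By [perpK], the sum of the restrictions is everything iff its orthogonal is
    zero. *)
Lemma full_sum_perp : full_sum V W <-> zero_intersection (perp V) (perp W).
Proof.
have Vaff := affine_self V_vs; have Waff := affine_self W_vs.
have PVaff := affine_self (perp_vspace V); have PWaff := affine_self (perp_vspace W).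
split => [[V' [W' [VV' WW' full]]]|[V' [W' [VV' WW' zero]]]].
  exists (perp V), (perp W); split=> //; rewrite -perp_sum_restrict.
  rewrite -perpT -full /sum_restrict.
  by rewrite (affine_translate_unique Vaff VV') (affine_translate_unique Waff WW').
exists V, W; split=> //.
rewrite -/sum_restrict -(perpK sum_restrict_vspace) -perp0 perp_sum_restrict -zero.
by rewrite (affine_translate_unique PVaff VV') (affine_translate_unique PWaff WW').
Qed.

End PerpPair.

Lemma zero_intersection_perp S P Q (V : set (vec F (S + P)))
    (W : set (vec F (P + Q))) : is_vspace V -> is_vspace W ->
  zero_intersection V W <-> full_sum (perp V) (perp W).
Proof.
move=> V_vs W_vs; rewrite -{1}(perpK V_vs) -{1}(perpK W_vs).
by rewrite -full_sum_perp //; apply: perp_vspace.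
Qed.

End Vectors.

Theorem theorem17 (F : fieldType) (A B C : finType)
    (AAB VAB : set (vec F (A + B))) (ABC VBC : set (vec F (B + C)))
    (hAB : affine_translate AAB VAB) (hBC : affine_translate ABC VBC)
    (hrigid : rigid AAB ABC) :
  [/\ (full_sum AAB ABC <->
         (forall (A'AB : set (vec F (A + B))) (A'BC : set (vec F (B + C))),
            affine_translate A'AB VAB -> affine_translate A'BC VBC ->
            mcomp A'AB A'BC !=set0)) /\
      (full_sum AAB ABC ->
         forall (A'AB : set (vec F (A + B))) (A'BC : set (vec F (B + C))),
           affine_translate A'AB VAB -> affine_translate A'BC VBC ->
           affine_translate (mcomp A'AB A'BC) (mcomp VAB VBC)),
      zero_intersection AAB ABC <->
        (forall (fA : vec F A) (fB fB' : vec F B) (fC : vec F C),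
           mcomp AAB ABC (vpair fA fC) ->
           cinter AAB ABC (vpair (vpair fA fB) fC) ->
           cinter AAB ABC (vpair (vpair fA fB') fC) -> fB = fB'),
      rigid AAB ABC <->
        (r (csum VAB VBC) = r VAB + r VBC)%N /\
        (r (csum (perp VAB) (perp VBC)) = r (perp VAB) + r (perp VBC))%N
    & [/\ zero_intersection AAB ABC <-> full_sum (perp VAB) (perp VBC),
          full_sum AAB ABC <-> zero_intersection (perp VAB) (perp VBC)
        & rigid AAB ABC <-> rigid (perp VAB) (perp VBC)]].
Proof.
have [[VAB_vs _] [VBC_vs _]] := (hAB, hBC).
have [full _] := hrigid.
have full_perp : full_sum AAB ABC <-> zero_intersection (perp VAB) (perp VBC).
  by rewrite (full_sum_translate hAB hBC) full_sum_perp.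
have zero_perp : zero_intersection AAB ABC <-> full_sum (perp VAB) (perp VBC).
  by rewrite (zero_intersection_translate hAB hBC) zero_intersection_perp.
have nonvoid := full_sum_mcomp hAB hBC.
split.
- split=> // fullA A'AB A'BC hAB' hBC'.
  by apply: affine_mcomp => //; apply: (proj1 nonvoid).
- exact: unique_match_zero_intersection hAB hBC (proj1 nonvoid full _ _ hAB hBC).
- rewrite -(r_csum VAB_vs VBC_vs) -(r_csum (perp_vspace VAB) (perp_vspace VBC)).
  by rewrite -full_perp -(zero_intersection_translate hAB hBC) /rigid and_comm.
- by split=> //; rewrite /rigid full_perp zero_perp and_comm.
Qed.
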